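(* Assume that there exist constants $\delta<1$ and $C>0$ such that the Markov chain $\xi_1,\xi_2,\ldots$ satisfies $$\|p^n(x,\cdot)-\pi(\cdot)\|_{TV}\le C\delta^n\quad\text{for all } n\in\mathbb{N}\text{ and } \pi\text{-almost every } x,$$ with $C$ independent of $x$, and that additionally $P^*$ has a representation of the form $$P^*f(x)=\int_\Omega f(y)\,p^*(x,dy),$$ where $p^*(\cdot,\cdot)$ is a transition probability kernel. Then $P$ has an $L^2(\pi)$-spectral gap and the spectral radius $\rho$ satisfies $$\rho\le\sqrt{\delta}.$$
   Context: Standing assumptions: $\xi_1,\xi_2,\ldots$ is a time-homogeneous, discrete-time, $\pi$-irreducible positive recurrent Markov chain on a state space $(\Omega,\mathcal{F})$ with $\mathcal{F}$ countably generated, transition kernel $p(\cdot,\cdot)$ ($n$-step kernel $p^n$) and unique invariant probability measure $\pi$. The Markov operator is $Pf(x)=\int_\Omega f(y)\,p(x,dy)$ on $L^2(\pi)$ and $P^*$ is its adjoint on $L^2(\pi)$. $\|\cdot\|_{TV}$ is the total variation norm. Put $L_0^2(\pi)=\{f\in L^2(\pi):\int f\,d\pi=0\}$ and $$\rho=\lim_{n\to\infty}\sup\{\|P^nf\|_2^{1/n}: f\in L_0^2(\pi),\|f\|_2=1\};$$ $P$ has an $L^2(\pi)$-spectral gap if $\rho<1$. *)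

(* Defs.v *)
From HB Require Import structures.
From mathcomp Require Import all_boot all_order all_algebra.
From mathcomp Require Import all_classical all_reals all_analysis.

Set Implicit Arguments.
Unset Strict Implicit.
Unset Printing Implicit Defensive.

Import Order.TTheory GRing.Theory Num.Theory.
Import numFieldNormedType.Exports.

Local Open Scope classical_set_scope.
Local Open Scope ring_scope.

Section nstep_kernel.
Context d (T : measurableType d) (R : realType).

Section composition.
Variables k1 k2 : R.-pker T ~> T.

Definition pker_comp : T -> {measure set T -> \bar R} := mkcomp_noparam k1 k2.

HB.instance Definition _ := SubProbabilityKernel.on pker_comp.

Let prob_pker_comp x : pker_comp x [set: T] = 1%E.
Proof.
rewrite /pker_comp /mkcomp_noparam /= /kcomp_noparam.
under eq_integral do rewrite prob_kernel.
by rewrite integral_cst// mul1e prob_kernel.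
Qed.

HB.instance Definition _ :=
  isProbabilityKernel.Build _ _ _ _ _ pker_comp prob_pker_comp.

End composition.

(* p^0 (x, .) is the Dirac mass at x and p^(n+1) (x, A) is the integral of
   p^n (y, A) with respect to p (x, dy). *)
Fixpoint nstep (p : R.-pker T ~> T) (n : nat) : R.-pker T ~> T :=
  if n is m.+1 then pker_comp p (nstep p m)
  else kdirac (@measurable_id _ T setT).

Definition pker_at (k : R.-pker T ~> T) (x : T) : set T -> \bar R := k x.

HB.instance Definition _ k x := Measure.on (pker_at k x).

Let pker_at_setT k x : pker_at k x setT = 1%E.
Proof. exact: prob_kernel. Qed.

HB.instance Definition _ k x :=
  Measure_isProbability.Build _ _ _ (pker_at k x) (@pker_at_setT k x).

End nstep_kernel.

Section total_variation.
Context d (T : measurableType d) (R : realType).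

(* |nu|(T) = nu^+(T) + nu^-(T).  The value does not depend on the Hahn
   decomposition that is selected (Hahn_decomposition_uniq). *)
Definition tv_norm (nu : {charge set T -> \bar R}) : \bar R :=
  charge_variation
    (projT2 (cid (projT2 (cid (Hahn_decomposition nu))))) [set: T].

Definition charge_diff (mu nu : {finite_measure set T -> \bar R}) :
    {charge set T -> \bar R} :=
  cadd (charge_of_finite_measure mu) (copp (charge_of_finite_measure nu)).

End total_variation.

Section markov_chain.
Context d (T : measurableType d) (R : realType).
Implicit Types (p : R.-pker T ~> T) (pi : probability T R).

Definition countably_generated :=
  exists2 G : set (set T), countable G & @measurable d T = <<s G >>.

Definition invariant p pi :=
  forall A, measurable A -> (\int[pi]_x p x A = pi A)%E.

Definition irreducible p pi :=
  forall x A, measurable A -> (0 < pi A)%E ->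
    exists2 n, (0 < n)%N & (0 < nstep p n x A)%E.

(* Started at x, the chain visits A infinitely often in expectation. *)
Definition recurrent p pi :=
  forall x A, measurable A -> (0 < pi A)%E ->
    (\sum_(1 <= n <oo) nstep p n x A = +oo)%E.

(* Positivity of the recurrent chain is the existence of an invariant
   probability measure. *)
Definition irreducible_positive_recurrent p pi :=
  [/\ irreducible p pi,
      recurrent p pi,
      invariant p pi &
      forall mu : probability T R, invariant p mu ->
        forall A, measurable A -> mu A = pi A].

End markov_chain.

Section L2_operators.
Context d (T : measurableType d) (R : realType).
Implicit Types (p : R.-pker T ~> T) (pi : probability T R).

(* The value is 0 at the points x where f is not p(x, .)-integrable: f is only
   a representative of a class modulo pi-null sets, and for f in L^2(pi) with
   pi invariant the exceptional points form a pi-null set. *)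
Definition markov_op p (f : T -> R) : T -> R := fun x => \int[p x]_y f y.

Definition L2 pi : set (T -> R) := [set f | f \in Lfun pi 2%:E].

Definition L2norm pi (f : T -> R) : \bar R := ('N[pi]_2%:E[EFin \o f])%E.

Definition L20 pi : set (T -> R) := [set f | L2 pi f /\ \int[pi]_x f x = 0].

Definition L2_adjoint pi (A B : (T -> R) -> (T -> R)) :=
  (forall f, L2 pi f -> L2 pi (B f)) /\
  forall f g, L2 pi f -> L2 pi g ->
    \int[pi]_x (A f x * g x) = \int[pi]_x (f x * B g x).

(* Supremum in [0, +oo]: adding 0 only matters when L^2_0(pi) = {0}, where
   the supremum over the (empty) unit sphere is read as 0. *)
Definition rho_seq p pi (n : nat) : \bar R :=
  ereal_sup ([set 0%E] `|`
    [set (L2norm pi (iter n (markov_op p) f) `^ (n%:R^-1))%E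
      | f in [set f | L20 pi f /\ L2norm pi f = 1%E]]).

Definition rho p pi : \bar R := limn (rho_seq p pi).

Definition L2_spectral_gap p pi := (rho p pi < 1)%E.

End L2_operators.

(* Main.v *)
(* For f in L^2_0(pi), P^n f(x) is the integral of f against the signed measure
   nu_x = p^n(x, .) - pi.  The Cauchy-Schwarz inequality for |nu_x| and
   |nu_x| <= p^n(x, .) + pi give
     |P^n f(x)|^2 <= |nu_x|(T) * (\int f^2 dp^n(x, .) + \int f^2 dpi),
   and integrating in x against the invariant pi,
     ||P^n f||_2^2 <= 2 C delta^n ||f||_2^2.
   The limit defining rho exists by Fekete's lemma, because the operator norms
   of P^n on L^2_0(pi) are submultiplicative. *)

Require Import Defs.
From HB Require Import structures.
From mathcomp Require Import all_boot all_order all_algebra.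
From mathcomp Require Import all_classical all_reals all_analysis.
From mathcomp Require Import measurable_realfun lra.

Import Order.TTheory GRing.Theory Num.Theory.
Import numFieldNormedType.Exports.

Local Open Scope classical_set_scope.
Local Open Scope ring_scope.

(** * Integration of nonnegative functions along a kernel *)

Section kernel_integral.
Context {d} {T : measurableType d} {R : realType}.
Implicit Types (p q : R.-pker T ~> T) (mu nu : probability T R).
Local Open Scope ereal_scope.

(** Invariance ([mu] and [nu] both equal to [pi]) and the Chapman-Kolmogorov relation ([mu] the
    one-step law from [x], [nu] the law after [n.+1] steps) are both instances, so each change of
    integral is proved once for the two. *)
Definition bind_eq mu q (nu : {measure set T -> \bar R}) :=
  forall A, measurable A -> \int[mu]_y q y A = nu A.

Lemma ge0_integral_bind mu q (nu : {measure set T -> \bar R}) :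
  bind_eq mu q nu -> forall f : T -> \bar R, (forall x, 0 <= f x) ->
  measurable_fun [set: T] f ->
  \int[mu]_y \int[q y]_z f z = \int[nu]_z f z.
Proof.
move=> muq f f0 mf.
(* Seen as a kernel from the one-point type, [mu] can be composed with [q], and [integral_kcomp]
   then gives the identity. *)
pose mu_ker : R.-pker unit ~> T := 
   kprobability (measurable_cst (mu : pprobability T R)).
pose q_ker : R.-sfker (unit * T) ~> T := kernel.kernel_snd (T0 := unit) q.
rewrite -(@integral_kcomp _ _ _ _ _ _ _ mu_ker q_ker tt f f0 mf).
apply: eq_measure_integral => A mA _.
by rewrite /kcomp/= -muq.
Qed.

Lemma bind_eq_invariant p mu : Defs.invariant p mu -> bind_eq mu p mu.
Proof. by []. Qed.

Lemma bind_eq_nstepS p n x :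
  bind_eq (pker_at p x) (nstep p n) (pker_at (nstep p n.+1) x).
Proof. by []. Qed.

Lemma invariant_nstep p mu n :
  Defs.invariant p mu -> Defs.invariant (nstep p n) mu.
Proof.
move=> pmu; elim: n => [|n ih] A mA.
  rewrite -[in RHS](setIT A) -integral_indic//; apply: eq_integral => x _ /=.
rewrite -ih//.
apply: (ge0_integral_bind _ _ _ (bind_eq_invariant _ _ pmu)) => //.
exact: (measurable_kernel (nstep p n) A mA).
Qed.

Lemma measurable_markov_op q (f : T -> R) :
  measurable_fun [set: T] f -> measurable_fun [set: T] (markov_op q f).
Proof.
move=> mf; apply: measurableT_comp => //.
(* The extended integral is the difference of the integrals of the two parts by convention, so this
   equality holds at every [x], whether or not [f] is integrable there. *)
rewrite (_ : (fun x => _) = (fun x => \int[q x]_y (EFin \o f)^\+ y -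
   \int[q x]_y (EFin \o f)^\- y)); last first.
  by apply/funext => x; rewrite integralE.
have mEf : measurable_fun [set: T] (EFin \o f) by exact/measurable_EFinP.
apply: emeasurable_funB; apply: measurable_fun_integral_kernel => //.
- by move=> U mU; exact: measurable_kernel.
- exact: measurable_funepos.
- by move=> U mU; exact: measurable_kernel.
- exact: measurable_funeneg.
Qed.

End kernel_integral.

(** * Real-valued integrals along a kernel, up to null sets *)

Section kernel_Rintegral.
Context {d} {T : measurableType d} {R : realType}.
Implicit Types (p q : R.-pker T ~> T) (mu : probability T R)
  (nu : {measure set T -> \bar R}) (f : T -> R).

(** A [nu]-null set has [q y]-mass of [mu]-mean zero, and a nonnegative function of mean zero
    vanishes almost everywhere. *)
Lemma ae_bind mu q nu (P : T -> Prop) : bind_eq mu q nu ->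
  {ae nu, forall x, P x} -> {ae mu, forall y, {ae q y, forall x, P x}}.
Proof.
move=> muq [N [mN nuN PN]].
have qN0 : (\int[mu]_y `|q y N| = 0)%E.
  by rewrite -nuN -muq//; apply: eq_integral => y _; rewrite gee0_abs.
have mqN : measurable_fun [set: T] (fun y => q y N) by exact: measurable_kernel.
have := (ae_eq_integral_abs mu measurableT mqN).1 qN0.
by apply: filterS => y /= /(_ I) qyN; exists N.
Qed.

(** By Tonelli the inner integrals of the absolute value of [f] have a finite [mu]-mean, so almost
    all of them are finite. *)
Lemma integrable_bind mu q nu f : bind_eq mu q nu ->
  nu.-integrable [set: T] (EFin \o f) ->
  {ae mu, forall y, (q y).-integrable [set: T] (EFin \o f)}.
Proof.
move=> muq /integrableP[mf fy].
have mnf : measurable_fun [set: T] (fun x => `|(EFin \o f) x|%E).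
  exact: measurableT_comp.
have : mu.-integrable [set: T] (fun y => \int[q y]_x `|(EFin \o f) x|)%E.
  apply/integrableP; split.
    apply: measurable_fun_integral_kernel => // U mU; exact: measurable_kernel.
  under eq_integral do rewrite gee0_abs ?integral_ge0//.
  by rewrite (ge0_integral_bind _ _ _ muq).
move/(integrable_ae measurableT); apply: filterS => y /= /(_ I) qy.
by apply/integrableP; split => //; rewrite ltey_eq qy.
Qed.

(** Positive and negative parts are handled by the nonnegative case and recombined, which is
    legitimate because both have finite integrals. *)
Lemma Rintegral_bind mu q nu f : bind_eq mu q nu ->
  nu.-integrable [set: T] (EFin \o f) ->
  \int[mu]_y markov_op q f y = \int[nu]_x f x.
Proof.
move=> muq fi; have mf := measurable_int _ fi.
have mf' : measurable_fun [set: T] f by exact/measurable_EFinP.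
have part (g : T -> \bar R) :
    (forall x, 0 <= g x)%E -> nu.-integrable [set: T] g ->
    mu.-integrable [set: T] (fun y => \int[q y]_x g x)%E.
  move=> g0 /integrableP[mg gy]; apply/integrableP; split.
    apply: measurable_fun_integral_kernel => // U mU; exact: measurable_kernel.
  under eq_integral do rewrite gee0_abs ?integral_ge0//.
  rewrite (ge0_integral_bind _ _ _ muq)//.
  by move: gy; under eq_integral do rewrite gee0_abs//.
have fp := part _ (funepos_ge0 _) (integrable_funepos measurableT fi).
have fn := part _ (funeneg_ge0 _) (integrable_funeneg measurableT fi).
congr fine; rewrite [RHS]integralE.
rewrite -!(ge0_integral_bind _ _ _ muq)//; last 2 first.
- exact: measurable_funeneg.
- exact: measurable_funepos.
(* The integrands agree only almost everywhere: where [f] is not [q y]-integrable, [markov_op] takes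
   the default value 0. *)
rewrite -integralB//; apply: ae_eq_integral => //.
- by apply/measurable_EFinP; exact: measurable_markov_op.
- exact: measurable_int (integrableB measurableT fp fn).
have := integrable_bind _ _ _ _ muq fi; apply: filterS => y yi _.
by rewrite /= -integralE fineK//; exact: integrable_fin_num.
Qed.

(** Only an almost-everywhere identity, because of the default value of [markov_op]. In the
    induction, the exceptional set for [n] is null for [p x] at almost every [x] by [ae_bind], so it
    does not affect the next integration. *)
Lemma iter_markov_op p mu n f : Defs.invariant p mu ->
  mu.-integrable [set: T] (EFin \o f) ->
  {ae mu, forall x, iter n (markov_op p) f x = markov_op (nstep p n) f x}.
Proof.
move=> pmu fi; have mf := measurable_int _ fi.
have mf' : measurable_fun [set: T] f by exact/measurable_EFinP.
elim: n => [|n ih].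
  apply: aeW => x /=; rewrite /markov_op /Rintegral.
  by rewrite integral_dirac//= indicT mul1r.
have h1 := ae_bind _ _ _ _ (bind_eq_invariant _ _ pmu) ih.
have h2 := integrable_bind _ _ _ _ (invariant_nstep p mu n.+1 pmu) fi.
apply: filterS2 h1 h2 => x hx fx; rewrite iterS.
rewrite -[RHS](Rintegral_bind _ _ _ _ (bind_eq_nstepS p n x) fx).
congr fine; apply: ae_eq_integral => //.
- apply/measurable_EFinP; elim: (n) => //= k; exact: measurable_markov_op.
- by apply/measurable_EFinP; exact: measurable_markov_op.
by apply: filterS hx => y /= -> _.
Qed.

End kernel_Rintegral.

(** * Square integrability, contraction and homogeneity of the Markov operator *)

Section square_integrals.
Context {d} {T : measurableType d} {R : realType}.
Implicit Types (p q : R.-pker T ~> T) (pi : probability T R)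
  (mu : {measure set T -> \bar R}) (f : T -> R).
Local Open Scope ereal_scope.

Lemma L2norm_sqr pi f : L2norm pi f `^ 2 = \int[pi]_x ((f x) ^+ 2)%:E.
Proof.
rewrite /L2norm poweR_Lnorm//; apply: eq_integral => x _.
by rewrite /= powR_mulrn// real_normK// num_real.
Qed.

Lemma L2normE pi f : L2norm pi f = (\int[pi]_x ((f x) ^+ 2)%:E) `^ 2^-1.
Proof. by rewrite -L2norm_sqr -poweRrM mulfV// poweRe1// Lnorm_ge0. Qed.

Lemma L2P pi f : L2 pi f <->
  measurable_fun [set: T] f /\ \int[pi]_x ((f x) ^+ 2)%:E < +oo.
Proof.
split.
  move=> /[dup] Lf; rewrite /L2/= => /andP[/[!inE]/= mf _]; split => //.
  have /integrableP[_] := Lfun2_integrable_sqr Lf.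
  by apply: le_lt_trans; apply: ge0_le_integral => //= [x _|||x _];
    rewrite ?lee_fin ?sqr_ge0//; do ?apply: measurableT_comp => //;
    [exact: measurable_funX|exact: measurable_funX|exact: ler_norm].
move=> [mf fy]; rewrite /L2/=; apply/andP; split; rewrite inE//=.
by rewrite /finite_norm -/(L2norm pi f) L2normE poweR_lty.
Qed.

(** Hölder's inequality with both exponents 2, for [f] and the constant 1. Extended values let it be
    used before integrability is known. *)
Lemma cauchy_schwarz1 mu f : measurable_fun [set: T] f ->
  (\int[mu]_x `|f x|%:E) `^ 2 <= mu [set: T] * \int[mu]_x ((f x) ^+ 2)%:E.
Proof.
move=> mf.
have pq : (2^-1 + 2^-1 = 1 :> R)%R by rewrite [RHS]splitr !div1r.
have /(gt0_ler_poweR (ler0n _ 2)) := @hoelder _ _ _ mu f (cst 1%R) 2 2 mf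
  (measurable_cst _) (ltr0Sn _ _) (ltr0Sn _ _) pq.
rewrite !in_itv/= !leey !andbT mule_ge0 ?Lnorm_ge0// => /(_ isT isT).
rewrite Lnorm1 poweRM ?Lnorm_ge0// !poweR_Lnorm//.
under [X in _ <= _ * X -> _]eq_integral do rewrite /= normr1 powR1.
under [X in X `^ 2 <= _ -> _]eq_integral do rewrite /= mulr1.
rewrite integral_cst// mul1e muleC => /le_trans; apply.
rewrite le_eqVlt; apply/predU1P; left; congr (_ * _).
apply: eq_integral => x _.
by rewrite /= powR_mulrn// real_normK// num_real.
Qed.

Lemma normr_Rintegral_le mu f : measurable_fun [set: T] f ->
  `|\int[mu]_x f x|%:E <= \int[mu]_x `|f x|%:E.
Proof.
move=> mf.
have mEf : measurable_fun [set: T] (EFin \o f) by exact/measurable_EFinP.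
apply: le_trans (le_abse_integral mu measurableT mEf).
(* If the extended integral is infinite, its real version is 0 and the bound is trivial. *)
by rewrite /Rintegral; case: (integral _ _ _) => [r||]//=; rewrite normr0 leey.
Qed.

Lemma Rintegral_sqr_le mu f : measurable_fun [set: T] f ->
  ((\int[mu]_x f x) ^+ 2)%R%:E <= mu [set: T] * \int[mu]_x ((f x) ^+ 2)%:E.
Proof.
move=> mf; apply: le_trans (cauchy_schwarz1 _ _ mf).
rewrite -[leLHS]/((_ ^+ 2)%:E) -(real_normK (num_real _)) -powR_mulrn//.
rewrite -poweR_EFin gt0_ler_poweR//.
- by rewrite in_itv/= leey andbT lee_fin normr_ge0.
- by rewrite in_itv/= leey andbT integral_ge0.
- exact: normr_Rintegral_le.
Qed.

(** Cauchy-Schwarz for the probability measure [p x] bounds the square of the mean by the mean of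
    the square; invariance then removes the kernel. *)
Lemma markov_op_contraction p pi f : Defs.invariant p pi ->
  measurable_fun [set: T] f ->
  \int[pi]_x ((markov_op p f x) ^+ 2)%:E <= \int[pi]_x ((f x) ^+ 2)%:E.
Proof.
move=> ppi mf.
have mf2 : measurable_fun [set: T] (fun x => ((f x) ^+ 2)%:E).
  exact/measurable_EFinP/measurable_funX.
have sq0 x : 0 <= ((f x) ^+ 2)%:E by rewrite lee_fin sqr_ge0.
rewrite -(ge0_integral_bind _ _ _ (bind_eq_invariant _ _ ppi) _ sq0)//.
apply: ge0_le_integral => //.
- by move=> x _; rewrite lee_fin sqr_ge0.
- exact/measurable_EFinP/measurable_funX/measurable_markov_op.
- apply: measurable_fun_integral_kernel => //.
  by move=> U mU; exact: measurable_kernel.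
- move=> x _; apply: le_trans; first exact: (Rintegral_sqr_le _ _ mf).
  by rewrite prob_kernel mul1e.
Qed.

Lemma measurable_iter_markov_op p f n : measurable_fun [set: T] f ->
  measurable_fun [set: T] (iter n (markov_op p) f).
Proof. by move=> mf; elim: n => // n ih; exact: measurable_markov_op. Qed.

Lemma iter_markov_op_contraction p pi f n : Defs.invariant p pi ->
  measurable_fun [set: T] f ->
  \int[pi]_x ((iter n (markov_op p) f x) ^+ 2)%:E <= \int[pi]_x ((f x) ^+ 2)%:E.
Proof.
move=> ppi mf; elim: n => // n; apply: le_trans; rewrite iterS.
exact/markov_op_contraction/measurable_iter_markov_op.
Qed.

Lemma L2_integrable pi f : L2 pi f -> pi.-integrable [set: T] (EFin \o f).
Proof.
move=> /L2P[mf fy]; apply/integrableP; split; first exact/measurable_EFinP.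
apply: (@lty_poweRy _ _ 2) => //; apply: (le_lt_trans (cauchy_schwarz1 _ _ mf)).
by rewrite [X in X * _](probability_setT pi) mul1e.
Qed.

Lemma L20_markov_op p pi f : Defs.invariant p pi -> L20 pi f ->
  L20 pi (markov_op p f).
Proof.
move=> ppi [Lf f0]; split; last first.
  by rewrite (Rintegral_bind _ _ _ _ (bind_eq_invariant _ _ ppi))//;
    exact: L2_integrable.
have [mf fy] := (L2P _ _).1 Lf; apply/L2P; split.
  exact: measurable_markov_op.
exact: le_lt_trans (markov_op_contraction _ _ _ ppi mf) fy.
Qed.

Lemma L20_iter_markov_op p pi f n : Defs.invariant p pi -> L20 pi f ->
  L20 pi (iter n (markov_op p) f).
Proof. by move=> ppi Lf; elim: n => // n; exact: L20_markov_op. Qed.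

Lemma L20_scale pi f (a : R) : L20 pi f -> L20 pi (fun x => a * f x)%R.
Proof.
move=> [Lf f0]; split; last first.
  by rewrite RintegralZl ?f0 ?mulr0//; exact: L2_integrable.
have [mf fy] := (L2P _ _).1 Lf; apply/L2P; split; first exact: measurable_funM.
under eq_integral do rewrite exprMn EFinM.
rewrite ge0_integralZl//.
- by rewrite lte_mul_pinfty// lee_fin sqr_ge0.
- exact/measurable_EFinP/measurable_funX.
- by move=> x _; rewrite lee_fin sqr_ge0.
- by rewrite lee_fin sqr_ge0.
Qed.

Lemma L2norm_scale pi f (a : R) : measurable_fun [set: T] f ->
  L2norm pi (fun x => a * f x)%R = `|a|%:E * L2norm pi f.
Proof.
move=> mf; rewrite !L2normE.
under eq_integral do rewrite exprMn EFinM.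
rewrite ge0_integralZl//; last 3 first.
- exact/measurable_EFinP/measurable_funX.
- by move=> x _; rewrite lee_fin sqr_ge0.
- by rewrite lee_fin sqr_ge0.
rewrite poweRM ?lee_fin ?sqr_ge0//; last first.
  by apply: integral_ge0 => x _; rewrite lee_fin sqr_ge0.
congr (_ * _); rewrite poweR_EFin -real_normK ?num_real// -powR_mulrn//.
by rewrite -powRrM mulfV// powRr1.
Qed.

Lemma Rintegral_nonintegrable mu f : measurable_fun [set: T] f ->
  ~ mu.-integrable [set: T] (EFin \o f) -> (\int[mu]_x f x = 0)%R.
Proof.
move=> mf nf; apply/eqP; apply: contra_notT nf => f0.
have mEf : measurable_fun [set: T] (EFin \o f) by exact/measurable_EFinP.
apply/integrableP; split => //.
rewrite integral_fin_num_abs//; apply: contraNT f0.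
by rewrite fin_numEn /Rintegral => /orP[]/eqP ->.
Qed.

(** For [a] nonzero, [f] and its multiple are integrable together, and otherwise both real integrals
    are 0. Homogeneity therefore holds at every point, which makes [iter_markov_op_scale] an
    equality of functions. *)
Lemma measurable_RintegralZl mu f (a : R) : measurable_fun [set: T] f ->
  (\int[mu]_x (a * f x) = a * \int[mu]_x f x)%R.
Proof.
move=> mf; have [->|a0] := eqVneq a 0%R.
  rewrite mul0r /Rintegral; under eq_integral do rewrite mul0r.
  by rewrite integral0.
have [fi|nfi] := pselect (mu.-integrable [set: T] (EFin \o f)).
  by rewrite RintegralZl.
rewrite (Rintegral_nonintegrable _ _ mf nfi) mulr0.
apply: Rintegral_nonintegrable; first exact: measurable_funM.
move=> /(integrableZl measurableT a^-1) afi; apply: nfi.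
apply: eq_integrable afi => // x _ /=.
by rewrite -EFinM mulKf.
Qed.

Lemma iter_markov_op_scale p f (a : R) n : measurable_fun [set: T] f ->
  iter n (markov_op p) (fun x => a * f x)%R =
  (fun x => a * iter n (markov_op p) f x)%R.
Proof.
move=> mf; elim: n => //= n ->; apply/funext => x.
exact/measurable_RintegralZl/measurable_iter_markov_op.
Qed.

End square_integrals.

(** * Differences of integrals controlled by total variation *)

Section total_variation_integral.
Context {d} {T : measurableType d} {R : realType}.
Local Open Scope ereal_scope.

Lemma integrable_le_measure (m1 m2 : {measure set T -> \bar R})
    (f : T -> \bar R) :
  (forall A, measurable A -> m1 A <= m2 A) ->
  m2.-integrable [set: T] f -> m1.-integrable [set: T] f.
Proof.
move=> m12 /integrableP[mf fy]; apply/integrableP; split => //.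
apply: le_lt_trans fy; apply: ge0_le_measure_integral => //.
exact: measurableT_comp.
Qed.

Variables mu nu : {finite_measure set T -> \bar R}.

(** Cauchy-Schwarz is applied to the variation measure [V], the sum of the Jordan parts [Jp] and
    [Jn]. Its mass is the total variation norm, and [Jp] is dominated by [mu] and [Jn] by [nu]. *)
Lemma tv_norm_Rintegral_sqr_le (f : T -> R) :
  mu.-integrable [set: T] (EFin \o f) -> nu.-integrable [set: T] (EFin \o f) ->
  ((\int[mu]_x f x - \int[nu]_x f x) ^+ 2)%R%:E <=
  tv_norm (charge_diff mu nu) *
    (\int[mu]_x ((f x) ^+ 2)%:E + \int[nu]_x ((f x) ^+ 2)%:E).
Proof.
move=> fmu fnu.
have mEf := measurable_int _ fmu; have /measurable_EFinP mf := mEf.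
rewrite /tv_norm; case: cid => P PN0 /=; case: cid => N PN /=.
pose Jp : {measure set T -> \bar R} := jordan_pos PN.
pose Jn : {measure set T -> \bar R} := jordan_neg PN.
pose V : {measure set T -> \bar R} := measure_add Jp Jn.
have [[mP _] [mN _] _ _] := PN.
(* On the positive set [P] the Jordan part is [mu - nu], hence at most [mu]; symmetrically for [N]
   and [nu]. This also makes [f] integrable for both parts. *)
have Jpmu A : measurable A -> Jp A <= mu A.
  move=> mA; have mAP := measurableI _ _ mA mP.
  have -> : Jp A = mu (A `&` P) - nu (A `&` P).
    by rewrite -[LHS]/(crestr0 (charge_diff mu nu) mP A) /crestr0 mem_set.
  rewrite (le_trans _ (le_measure mu _ _ (@subIsetl _ A P))) ?inE//.
  by rewrite leeBlDr ?fin_num_measure// leeDl.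
have Jnnu A : measurable A -> Jn A <= nu A.
  move=> mA; have mAN := measurableI _ _ mA mN.
  have -> : Jn A = - (mu (A `&` N) - nu (A `&` N)).
    by rewrite -[LHS]/(cscale (-1) (crestr0 (charge_diff mu nu) mN) A)
      cscaleN1/= /crestr0 mem_set.
  rewrite (le_trans _ (le_measure nu _ _ (@subIsetl _ A N))) ?inE//.
  rewrite fin_num_oppeB ?fin_num_measure//.
  by rewrite addeC leeBlDr ?fin_num_measure// leeDl.
have Jpf := integrable_le_measure _ _ _ Jpmu fmu.
have Jnf := integrable_le_measure _ _ _ Jnnu fnu.
(* [mu + Jn] and [nu + Jp] are the same measure. *)
have split_integral : (\int[mu]_x f x + \int[Jn]_x f x =
    \int[nu]_x f x + \int[Jp]_x f x)%R.
  rewrite /Rintegral -!fineD; try exact: integrable_fin_num.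
  rewrite -!integral_measure_add//; congr fine.
  apply: eq_measure_integral => A mA _.
  transitivity (mu A + Jn A); first exact: measure_addE.
  transitivity (nu A + Jp A); last by apply/esym; exact: measure_addE.
  have : mu A - nu A = Jp A - Jn A.
    by have := jordan_decomp PN mA; rewrite /cadd/= cscaleN1.
  have : Jp A \is a fin_num.
    by rewrite -[Jp A]/(jordan_pos PN A) fin_num_measure.
  have : Jn A \is a fin_num.
    by rewrite -[Jn A]/(jordan_neg PN A) fin_num_measure.
  (* All four masses are finite, so the Jordan identity can be rearranged among real numbers. *)
  move: (fin_num_measure mu A mA) (fin_num_measure nu A mA).
  move=> /fineK <- /fineK <- /fineK <- /fineK <-.
  move=> -[] e; congr EFin; lra.
have -> : (\int[mu]_x f x - \int[nu]_x f x =
    \int[Jp]_x f x - \int[Jn]_x f x)%R by lra.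
have fV_ge0 (g : T -> \bar R) :
    measurable_fun [set: T] g -> (forall x, 0 <= g x) ->
    \int[V]_x g x = \int[Jp]_x g x + \int[Jn]_x g x.
  by move=> mg g0; exact: ge0_integral_measure_add.
have mf2 : measurable_fun [set: T] (fun x => ((f x) ^+ 2)%:E).
  exact/measurable_EFinP/measurable_funX.
have f2_ge0 x : 0 <= ((f x) ^+ 2)%:E by rewrite lee_fin sqr_ge0.
apply: (@le_trans _ _ (V [set: T] * \int[V]_x ((f x) ^+ 2)%:E)); last first.
  rewrite [X in X * _](_ : _ = charge_variation PN [set: T]); last first.
    exact: measure_addE.
  apply: lee_wpmul2l; first exact: adde_ge0.
  by rewrite fV_ge0// leeD//; apply: ge0_le_measure_integral.
apply: le_trans (cauchy_schwarz1 _ _ mf).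
rewrite -[leLHS]/((_ ^+ 2)%:E) -(real_normK (num_real _)) -powR_mulrn//.
rewrite -poweR_EFin gt0_ler_poweR//.
- by rewrite in_itv/= leey andbT lee_fin normr_ge0.
- by rewrite in_itv/= leey andbT integral_ge0.
rewrite fV_ge0//; last by do 2 apply: measurableT_comp => //.
apply: (@le_trans _ _ (`|\int[Jp]_x f x| + `|\int[Jn]_x f x|)%:E).
  by rewrite lee_fin ler_normB.
by rewrite EFinD leeD// normr_Rintegral_le.
Qed.
End total_variation_integral.

(** * Decay of the iterates on mean-zero functions *)

Section decay.
Context {d} {T : measurableType d} {R : realType}.
Local Open Scope ereal_scope.

(** The pointwise bound is integrated against [pi]. By invariance under the [n]-step kernel both of
    its square integrals contribute the same amount, whence the factor 2. *)
Lemma uniform_tv_L20_contraction (p : R.-pker T ~> T) (pi : probability T R)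
    (n : nat) (t : R) (f : T -> R) : Defs.invariant p pi -> (0 <= t)%R ->
  {ae pi, forall x, tv_norm (charge_diff (pker_at (nstep p n) x) pi) <= t%:E} ->
  L20 pi f ->
  \int[pi]_x ((iter n (markov_op p) f x) ^+ 2)%:E <=
    (2 * t)%:E * \int[pi]_x ((f x) ^+ 2)%:E.
Proof.
move=> ppi t0 tvt [Lf f0].
have fi := L2_integrable _ _ Lf.
have [mf _] := (L2P _ _).1 Lf.
have pnpi := invariant_nstep _ _ n ppi.
have mf2 : measurable_fun [set: T] (fun x => ((f x) ^+ 2)%:E).
  exact/measurable_EFinP/measurable_funX.
have f2_ge0 x : 0 <= ((f x) ^+ 2)%:E by rewrite lee_fin sqr_ge0.
have if2_ge0 (m : {measure set T -> \bar R}) : 0 <= \int[m]_x ((f x) ^+ 2)%:E.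
  exact: integral_ge0.
have mG : measurable_fun [set: T]
    (fun x => \int[nstep p n x]_y ((f y) ^+ 2)%:E).
  by apply: measurable_fun_integral_kernel => // U mU; exact: measurable_kernel.
have -> : (2 * t)%:E * \int[pi]_x ((f x) ^+ 2)%:E =
    \int[pi]_x (t%:E * (\int[nstep p n x]_y ((f y) ^+ 2)%:E +
      \int[pi]_x ((f x) ^+ 2)%:E)).
  rewrite ge0_integralZl//; last 2 first.
  - by apply: emeasurable_funD.
  - by move=> x _; rewrite adde_ge0.
  rewrite ge0_integralD// integral_cst//.
  rewrite [X in _ + _ * X](probability_setT pi) mule1.
  rewrite (ge0_integral_bind _ _ _ (bind_eq_invariant _ _ pnpi))//.
  by rewrite mulrC EFinM -muleA -mule2n mule_natl.
apply: ae_ge0_le_integral => //.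
- by move=> x _; rewrite lee_fin sqr_ge0.
- exact/measurable_EFinP/measurable_funX/measurable_iter_markov_op.
- by move=> x _; rewrite mule_ge0// adde_ge0.
- by apply: measurable_funeM; apply: emeasurable_funD.
have h1 := iter_markov_op p pi n f ppi fi.
have h2 := integrable_bind _ _ _ _ (bind_eq_invariant _ _ pnpi) fi.
apply: filterS3 h1 h2 tvt => x /= -> fx tx _.
apply: (@le_trans _ _ (tv_norm (charge_diff (pker_at (nstep p n) x) pi) *
   (\int[nstep p n x]_y ((f y) ^+ 2)%:E + \int[pi]_x ((f x) ^+ 2)%:E))).
  (* As [f] has mean 0, subtracting its [pi]-integral changes nothing. *)
  have := tv_norm_Rintegral_sqr_le (pker_at (nstep p n) x) pi f fx fi.
  by rewrite f0 subr0.
by rewrite lee_wpmul2r// adde_ge0.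
Qed.
End decay.

(** * Fekete's lemma in multiplicative form *)

Section fekete.
Context {R : realType}.
Implicit Types (u : R^nat) (c K : R).

Lemma cvg_root1 K : 0 < K -> K `^ n%:R^-1 @[n --> \oo] --> (1 : R).
Proof.
move=> K0; rewrite /powR gt_eqF// -[X in _ --> X]expR0.
apply: continuous_cvg; first exact: continuous_expR.
rewrite -[X in _ --> X](mul0r (ln K)); apply: cvgMr_tmp.
apply/gtr0_cvgV0; last exact: cvgr_idn.
by near=> n; rewrite ltr0n; near: n; exact: nbhs_infty_gt.
Unshelve. all: by end_near. Qed.

(** Write [n] as a multiple of [m] plus a remainder: the multiple costs a power of [c], and the
    finitely many remainders are absorbed in [K]. *)
Lemma submultiplicative_growth u c m :
  (0 < m)%N -> 0 < c -> (forall n, 0 <= u n) ->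
  (forall m n, u (m + n)%N <= u m * u n) -> u m <= c ^+ m ->
  exists2 K, 0 < K & forall n, u n <= K * c ^+ n.
Proof.
move=> m0 c0 u0 usub umc.
have us0 s : 0 <= u s / c ^+ s.
  by rewrite divr_ge0 ?u0// exprn_ge0// ltW.
(* The sum dominates the ratio at every remainder; the added 1 keeps [K] positive even if all ratios
   vanish. *)
exists (1 + \sum_(s < m) u s / c ^+ s).
  by rewrite ltr_pwDl// sumr_ge0.
move=> n.
have mulm q s : u (q * m + s)%N <= c ^+ (q * m) * u s.
  elim: q => [|q ih]; first by rewrite mul0n expr0 mul1r add0n.
  rewrite mulSn -addnA (le_trans (usub _ _))// exprD -mulrA ler_pM//.
rewrite {1 2}(divn_eq n m) (le_trans (mulm _ _))// exprD mulrCA.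
apply: ler_wpM2l; first by rewrite exprn_ge0// ltW.
rewrite -ler_pdivrMr ?exprn_gt0//.
rewrite (bigD1 (Ordinal (ltn_pmod n m0)))//= addrCA lerDl addr_ge0//.
by rewrite sumr_ge0.
Qed.

Lemma root_le_geometric u c K n : (0 < n)%N -> 0 <= c -> 0 < K -> 0 <= u n ->
  u n <= K * c ^+ n -> u n `^ n%:R^-1 <= K `^ n%:R^-1 * c.
Proof.
move=> n0 c0 K0 un0 unK.
have -> : K `^ n%:R^-1 * c = (K * c ^+ n) `^ n%:R^-1.
  rewrite powRM ?exprn_ge0 ?(ltW K0)//; congr (_ * _).
  by rewrite -powR_mulrn// -powRrM mulfV ?powRr1// pnatr_eq0 -lt0n.
by rewrite ge0_ler_powR ?invr_ge0// nnegrE// mulr_ge0 ?exprn_ge0 ?(ltW K0).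
Qed.

(** The limit is the infimum of the roots over positive indices. Index 0 is left out because its
    exponent is 0, which makes that root 1. *)
Lemma fekete u : (forall n, 0 <= u n) ->
  (forall m n, u (m + n)%N <= u m * u n) ->
  cvgn (fun n => u n `^ n%:R^-1).
Proof.
move=> u0 usub; set v := fun n => _.
pose S := [set v n | n in [set n | (0 < n)%N]].
have infS : has_inf S.
  split; first by exists (v 1%N); exists 1%N.
  by exists 0 => _ [n _ <-]; exact: powR_ge0.
apply/cvg_ex; exists (inf S); apply/cvgrPdist_lt => e e0.
have [_ [m m0 <-] vm] := inf_adherent e0 infS.
(* The midpoint is positive even when [v m] is 0, and lies strictly below [inf S + e], leaving room
   for the root of [K], which tends to 1. *)
pose c := (v m + (inf S + e)) / 2.
have c0 : 0 < c.
  have := powR_ge0 (u m) m%:R^-1; rewrite -/(v m) /c; lra.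
have umc : u m <= c ^+ m.
  have -> : u m = v m ^+ m.
    rewrite -powR_mulrn ?powR_ge0// /v -powRrM mulVf ?powRr1//.
    by rewrite pnatr_eq0 -lt0n.
  rewrite lerXn2r ?nnegrE ?powR_ge0 ?(ltW c0)// /c; lra.
have [K K0 uK] := submultiplicative_growth _ _ _ m0 c0 u0 usub umc.
have lim : K `^ n%:R^-1 * c @[n --> \oo] --> c.
  by rewrite -[X in _ --> X]mul1r; apply: cvgMr_tmp; exact: cvg_root1.
have cS : c < inf S + e by rewrite /c; lra.
near=> n.
have n0 : (0 < n)%N by near: n; exact: nbhs_infty_gt.
have vS : inf S <= v n by apply: ge_inf; [case: infS|exists n].
have : v n < inf S + e.
  apply: le_lt_trans (root_le_geometric _ _ _ _ n0 (ltW c0) K0 (u0 n) (uK n)) _.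
  near: n; exact: (cvgr_lt c lim).
rewrite distrC ger0_norm ?subr_ge0//; lra.
Unshelve. all: by end_near. Qed.

End fekete.

(** * Operator norms of the iterates and existence of the limit [rho] *)

Section L2_operator_norms.
Context {d} {T : measurableType d} {R : realType}.
Variables (p : R.-pker T ~> T) (pi : probability T R).
Hypothesis p_pi : Defs.invariant p pi.
Local Open Scope ereal_scope.

Lemma L2norm_iter_contraction (n : nat) (f : T -> R) :
  measurable_fun [set: T] f ->
  L2norm pi (iter n (markov_op p) f) <= L2norm pi f.
Proof.
move=> mf; rewrite !L2normE gt0_ler_poweR//.
- by rewrite in_itv/= leey andbT integral_ge0// => x _; rewrite lee_fin sqr_ge0.
- by rewrite in_itv/= leey andbT integral_ge0// => x _; rewrite lee_fin sqr_ge0.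
- exact: iter_markov_op_contraction.
Qed.

Lemma rho_seq_ge0 n : 0 <= rho_seq p pi n.
Proof. by apply: ereal_sup_ubound; left. Qed.

Lemma rho_seq_le (n : nat) (M : R) : (0 <= M)%R ->
  (forall f, L20 pi f -> L2norm pi f = 1 ->
    L2norm pi (iter n (markov_op p) f) <= M%:E) ->
  rho_seq p pi n <= (M `^ n%:R^-1)%:E.
Proof.
move=> M0 Mn; apply: ge_ereal_sup => _ [->|[f [f0 f1] <-]].
  by rewrite lee_fin powR_ge0.
rewrite -poweR_EFin gt0_ler_poweR ?invr_ge0//; last exact: Mn.
- by rewrite in_itv/= leey Lnorm_ge0.
- by rewrite in_itv/= leey lee_fin M0.
Qed.

(** The [n]-th power of [rho_seq p pi n] serves as the operator norm of the [n]-th iterate on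
    mean-zero functions; [f] is normalised to reach the unit sphere. *)
Lemma L2norm_iter_le (n : nat) (f : T -> R) : (0 < n)%N ->
  rho_seq p pi n \is a fin_num -> L20 pi f ->
  L2norm pi (iter n (markov_op p) f) <=
    (fine (rho_seq p pi n) ^+ n)%:E * L2norm pi f.
Proof.
move=> n0 rfin f20; have [mf fy] := (L2P _ _).1 f20.1.
have Nfin : L2norm pi f \is a fin_num.
  by rewrite ge0_fin_numE ?Lnorm_ge0// L2normE poweR_lty.
(* A function of norm 0 cannot be normalised; contraction settles this case. *)
have [f0|f0] := eqVneq (L2norm pi f) 0.
  by rewrite f0 mule0 -f0 L2norm_iter_contraction.
set a := fine (L2norm pi f).
have a0 : (0 < a)%R by rewrite fine_gt0// lt0e f0 Lnorm_ge0 ltey_eq Nfin.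
pose g := (fun x => a^-1 * f x)%R.
have ga : L2norm pi g = 1.
  rewrite L2norm_scale// ger0_norm ?invr_ge0 ?(ltW a0)// -(fineK Nfin) -EFinM.
  by rewrite mulVf// gt_eqF.
have g20 : L20 pi g by exact: L20_scale.
have gr : L2norm pi (iter n (markov_op p) g) `^ n%:R^-1 <= rho_seq p pi n.
  by apply: ereal_sup_ubound; right; exists g.
have n0' : n%:R != 0%R :> R by rewrite pnatr_eq0 -lt0n.
have gle :
    L2norm pi (iter n (markov_op p) g) <= (fine (rho_seq p pi n) ^+ n)%:E.
  rewrite -[leLHS]poweRe1 ?Lnorm_ge0// -(mulVf n0') poweRrM.
  rewrite -powR_mulrn ?fine_ge0 ?rho_seq_ge0// -poweR_EFin fineK//.
  rewrite gt0_ler_poweR//; rewrite in_itv/= leey ?poweR_ge0 ?rho_seq_ge0//.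
move: gle; rewrite iter_markov_op_scale// L2norm_scale; last first.
  exact: measurable_iter_markov_op.
rewrite ger0_norm ?invr_ge0 ?(ltW a0)// => gle.
have -> : L2norm pi (iter n (markov_op p) f) =
    a%:E * (a^-1%:E * L2norm pi (iter n (markov_op p) f)).
  by rewrite muleA -EFinM mulfV ?mul1e// gt_eqF.
by rewrite -[in leRHS](fineK Nfin) [leRHS]muleC lee_pmul2l.
Qed.

Lemma rho_seq_root_bound (K c : R) (n : nat) :
  (0 < n)%N -> (0 < K)%R -> (0 <= c)%R ->
  (forall f, L20 pi f -> \int[pi]_x ((iter n (markov_op p) f x) ^+ 2)%:E <=
    ((K * c ^+ n) ^+ 2)%:E * \int[pi]_x ((f x) ^+ 2)%:E) ->
  rho_seq p pi n <= (K `^ n%:R^-1 * c)%:E.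
Proof.
move=> n0 K0 c0 Kc.
have Kc0 : (0 <= K * c ^+ n)%R by rewrite mulr_ge0 ?exprn_ge0// ltW.
apply: (@le_trans _ _ ((K * c ^+ n) `^ n%:R^-1)%:E).
  apply: rho_seq_le => // f f20 f1.
  have := Kc _ f20; rewrite -!L2norm_sqr f1 poweR1r mule1.
  have half0 : (0 <= 2^-1 :> R)%R by rewrite invr_ge0.
  move=> /(gt0_ler_poweR half0).
  rewrite !in_itv/= !leey !andbT lee_fin sqr_ge0 poweR_ge0 => /(_ isT isT).
  rewrite -poweRrM mulfV// poweRe1 ?Lnorm_ge0// => /le_trans; apply.
  by rewrite lee_fin -powR_mulrn// -powRrM mulfV// powRr1.
by rewrite lee_fin; apply: (root_le_geometric (fun n => K * c ^+ n)%R).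
Qed.

Lemma cvg_rho_seq : (forall n, (0 < n)%N -> rho_seq p pi n \is a fin_num) ->
  exists2 l : R, rho_seq p pi n @[n --> \oo] --> l%:E & rho p pi = l%:E.
Proof.
(* Here [u 0] is 1 whatever [rho_seq p pi 0] is, so submultiplicativity is trivial when one index is
   0. *)
move=> rfin; pose u n := (fine (rho_seq p pi n) ^+ n)%R.
have u0 n : (0 <= u n)%R by rewrite exprn_ge0// fine_ge0// rho_seq_ge0.
have uroot n : (0 < n)%N -> (u n `^ n%:R^-1)%R = fine (rho_seq p pi n).
  move=> n0; rewrite /u -powR_mulrn ?fine_ge0 ?rho_seq_ge0// -powRrM mulfV.
    by rewrite powRr1// fine_ge0// rho_seq_ge0.
  by rewrite pnatr_eq0 -lt0n.
have usub m n : (u (m + n)%N <= u m * u n)%R.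
  have [->|m0] := posnP m; first by rewrite /u expr0 mul1r add0n.
  have [->|n0] := posnP n; first by rewrite /u expr0 mulr1 addn0.
  have mn0 : (0 < m + n)%N by rewrite addn_gt0 m0.
  have : rho_seq p pi (m + n) <= ((u m * u n) `^ (m + n)%:R^-1)%:E.
    apply: rho_seq_le => [|f f20 f1]; first exact: mulr_ge0.
    rewrite iterD.
    (* The [n]-th iterate of [f] is again in [L20], so the bound for [m] steps applies to it. *)
    apply: le_trans (L2norm_iter_le _ _ m0 (rfin _ m0) _) _.
      exact: L20_iter_markov_op.
    rewrite EFinM; apply: lee_wpmul2l; first by rewrite lee_fin; exact: u0.
    by have := L2norm_iter_le _ _ n0 (rfin _ n0) f20; rewrite f1 mule1.
  rewrite -(fineK (rfin _ mn0)) lee_fin => r_le.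
  apply: le_trans (lerXn2r _ _ _ r_le) _.
  - by rewrite nnegrE fine_ge0// rho_seq_ge0.
  - by rewrite nnegrE powR_ge0.
  rewrite -powR_mulrn ?powR_ge0// -powRrM mulVf ?powRr1 ?mulr_ge0//.
  by rewrite pnatr_eq0 -lt0n.
have /cvg_ex[l lu] := fekete u u0 usub.
have rl : rho_seq p pi n @[n --> \oo] --> l%:E.
  apply: cvg_EFin.
    by near=> n; apply: rfin; near: n; exact: nbhs_infty_gt.
  apply: cvg_trans lu; apply: near_eq_cvg.
  by near=> n; rewrite /= -uroot//; near: n; exact: nbhs_infty_gt.
by exists l => //; exact/cvg_lim.
Unshelve. all: by end_near. Qed.

(** The prefactor [K] disappears in the limit because its [n]-th root tends to 1. *)
Lemma rho_le_geometric (K c : R) : (0 < K)%R -> (0 <= c)%R ->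
  (forall n f, (0 < n)%N -> L20 pi f ->
    \int[pi]_x ((iter n (markov_op p) f x) ^+ 2)%:E <=
    ((K * c ^+ n) ^+ 2)%:E * \int[pi]_x ((f x) ^+ 2)%:E) ->
  cvgn (rho_seq p pi) /\ rho p pi <= c%:E.
Proof.
move=> K0 c0 Kc.
have bound n : (0 < n)%N -> rho_seq p pi n <= (K `^ n%:R^-1 * c)%:E.
  by move=> n0; apply: rho_seq_root_bound => // f; exact: Kc.
have rfin n : (0 < n)%N -> rho_seq p pi n \is a fin_num.
  move=> n0; rewrite ge0_fin_numE ?rho_seq_ge0//.
  by rewrite (le_lt_trans (bound _ n0))// ltry.
have [l rl ->] := cvg_rho_seq rfin.
split; first by apply/cvg_ex; exists l%:E.
have Kc_cvg : (K `^ n%:R^-1 * c)%:E @[n --> \oo] --> c%:E.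
  apply: cvg_EFin; first exact: nearW.
  by rewrite -[X in _ --> X]mul1r; apply: cvgMr_tmp; exact: cvg_root1.
apply: lee_cvg_to rl Kc_cvg _.
by near=> n; apply: bound; near: n; exact: nbhs_infty_gt.
Unshelve. all: by end_near. Qed.

End L2_operator_norms.

Theorem corollary5 (R : realType) (d : measure_display) (T : measurableType d)
    (p : R.-pker T ~> T) (pi : probability T R)
    (T_countably_generated : countably_generated T)
    (p_chain : irreducible_positive_recurrent p pi)
    (delta C : R) (delta_lt1 : delta < 1) (C_gt0 : 0 < C)
    (p_tv : forall n : nat, (0 < n)%N ->
      {ae pi, forall x,
        (tv_norm (charge_diff (pker_at (nstep p n) x) pi)
           <= (C * delta ^+ n)%:E)%E})
    (Pstar : (T -> R) -> (T -> R))
    (Pstar_adjoint : L2_adjoint pi (markov_op p) Pstar)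
    (pstar : R.-pker T ~> T)
    (Pstar_repr : forall f, L2 pi f ->
      {ae pi, forall x, Pstar f x = markov_op pstar f x}) :
  [/\ cvgn (rho_seq p pi),
      L2_spectral_gap p pi &
      (rho p pi <= (Num.sqrt delta)%:E)%E].
Proof.
have [_ _ p_pi _] := p_chain.
have p_tv0 n : (0 < n)%N -> 0 <= C * delta ^+ n.
  move=> n0; rewrite leNgt; apply/negP => Cn0.
  have [N [mN piN0 subN]] := p_tv n n0.
  (* A negative bound would fail at every point, as the total variation norm is nonnegative; the
     exceptional set would be the whole space, which has mass 1. *)
  suff NT : N = setT.
    by move: piN0; rewrite NT probability_setT => -[] /eqP; rewrite oner_eq0.
  apply/seteqP; split=> // x _; apply: subN => /=; apply/negP; rewrite -ltNge.
  by apply: lt_le_trans (_ : (_ < 0)%E) _; [rewrite lte_fin|exact: adde_ge0].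
have delta0 : 0 <= delta.
  by have := p_tv0 1%N isT; rewrite expr1 pmulr_rge0.
(* This [K] is chosen so that the square of [K * Num.sqrt delta ^+ n] is [2 * C * delta ^+ n], the
   decay factor obtained from total variation. *)
have K0 : 0 < Num.sqrt (2 * C) by rewrite sqrtr_gt0 mulr_gt0.
have [|rho_cvg rho_le] :=
    rho_le_geometric p pi p_pi _ _ K0 (sqrtr_ge0 delta).
  move=> n f n0 f20.
  rewrite exprMn -exprM mulnC exprM !sqr_sqrtr ?mulr_ge0 ?(ltW C_gt0)//.
  rewrite -mulrA; apply: uniform_tv_L20_contraction => //; first exact: p_tv0.
  exact: p_tv.
split => //; apply: le_lt_trans rho_le _.
by rewrite lte_fin -sqrtr1 ltr_sqrt.
Qed.
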